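(* Let $G$ be a finite non-abelian group and let $g \in K(G)$. Let $|E(\Gamma_G^g)|$ denote the number of edges of $\Gamma_G^g$. Then: (a) If $g = 1$, then $2|E(\Gamma_G^1)| = |G|\left(|G| - |\mathrm{Irr}(G)|\right)$. (b) If $g \neq 1$ and $g^2 = 1$, then $2|E(\Gamma_G^g)| = |G|\left(|G| - 1 - \sum_{\phi \in \mathrm{Irr}(G)} \frac{\phi(g)}{\phi(1)}\right)$. (c) If $g \neq 1$ and $g^2 \neq 1$, then $2|E(\Gamma_G^g)| = |G|\left(|G| - 1 - 2\sum_{\phi \in \mathrm{Irr}(G)} \frac{\phi(g)}{\phi(1)}\right)$.
   Context: For $x,y$ in a group, $[x,y] = x^{-1}y^{-1}xy$, and $K(G) = \{[x,y] : x,y \in G\}$. The $g$-noncommuting graph $\Gamma_G^g$ is the simple undirected graph with vertex set $G$ in which two distinct vertices $x,y$ are adjacent if and only if $[x,y] \neq g$ and $[x,y] \neq g^{-1}$. $\mathrm{Irr}(G)$ is the set of all irreducible complex characters of $G$. *)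

(* Defs.v *)
From mathcomp Require Import all_boot all_fingroup.

Set Implicit Arguments.
Unset Strict Implicit.
Unset Printing Implicit Defensive.

Local Open Scope group_scope.

Section NoncommutingGraph.

Variable gT : finGroupType.
Implicit Types (G : {group gT}) (g x y : gT).

(* K(G) is only the set of commutators, not the derived subgroup it generates.
   In the library [~ x, y] = x^-1 * x ^ y, that is, x^-1 y^-1 x y. *)
Definition commutators G : {set gT} := commg_set G G.

(* The vertex set is the subset G of the ambient type gT, so adjacency also
   requires both endpoints to lie in G. *)
Definition ncgraph G g : rel gT := fun x y =>
  [&& x \in G, y \in G, x != y, [~ x, y] != g & [~ x, y] != g^-1].

Lemma ncgraph_sym G g : symmetric (ncgraph G g).
Proof.
have flip x y h : ([~ x, y] == h) = ([~ y, x] == h^-1).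
  by rewrite -(inj_eq invg_inj) invgR.
move=> x y; rewrite /ncgraph [x == y]eq_sym (flip x y g) (flip x y g^-1) invgK.
by rewrite andbCA [X in [&& _, _, _ & X]]andbC.
Qed.

Lemma ncgraph_irrefl G g : irreflexive (ncgraph G g).
Proof. by move=> x; rewrite /ncgraph eqxx !andbF. Qed.

End NoncommutingGraph.

(* Edges are unordered pairs: each edge is counted once. *)
Definition edges (T : finType) (e : rel T) : {set {set T}} :=
  [set [set p.1; p.2] | p in [pred p : T * T | e p.1 p.2]].

(* Main.v *)
Require Import Defs.
From mathcomp Require Import all_boot all_order all_algebra all_fingroup
  all_solvable all_field all_character.

Set Implicit Arguments.
Unset Strict Implicit.
Unset Printing Implicit Defensive.

Import Order.TTheory GRing.Theory Num.Theory.
Local Open Scope ring_scope.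

(** By the handshake lemma, twice the number of edges is the number of ordered
    adjacent pairs, so it suffices to count the pairs of G x G that are not
    adjacent.  These are the diagonal pairs together with the fibres of the
    commutator map over g and g^-1.  Exchanging x and y inverts [x, y], so the
    two fibres have the same size; the three cases of the theorem say which of
    these three sets coincide, include one another, or are disjoint.

    The size of a fibre is given by Frobenius' formula
      #|{(x, y) | [x, y] = g}| = #|G| * \sum_phi phi(g) / phi(1)
    (card_commutator_fibre).  For fixed x, [x, y] = g means x ^ y = x g, and the
    number of such y is #|'C_G[x g]| or 0 according to whether x g is conjugate
    to x.  Column orthogonality turns this into \sum_phi phi(x g) phi(x)^*;
    summing over x and applying the generalized row orthogonality relation to
    each phi gives the formula.  At g = 1 every summand is 1, so the sum is the
    number of irreducible characters. *)

(** Each edge {a, b} is the image of exactly the two arcs (a, b) and (b, a). *)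
Lemma handshake (T : finType) (e : rel T) :
  symmetric e -> irreflexive e ->
  (2 * #|edges e|)%N = #|[set p : T * T | e p.1 p.2]|.
Proof.
move=> e_sym e_irr; rewrite -(sum1_card (mem [set p | _])).
rewrite (partition_big_imset (fun p : T * T => [set p.1; p.2])) /=.
have -> : [set [set p.1; p.2] | p in [set p : T * T | e p.1 p.2]] = edges e.
  by apply/setP=> E; apply/imsetP/imsetP=> -[p]; rewrite inE => ep ->;
    exists p; rewrite ?inE.
rewrite mulnC -sum_nat_const; apply: eq_bigr => E /imsetP[[a b] /= eab ->].
rewrite inE /= in eab.
have neq_ab : a != b by apply: contraTneq eab => ->; rewrite e_irr.
rewrite sum1_card (_ : #|_| = #|[set (a, b); (b, a)]|); last first.
  apply: eq_card => -[x y]; rewrite unfold_in !inE /= !xpair_eqE.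
  apply/andP/orP => [[exy /eqP eqE]|[]/andP[/eqP-> /eqP->]]; first 1 last.
  - by rewrite eqxx.
  - by rewrite e_sym setUC eqxx.
  have neq_xy : x != y by apply: contraTneq exy => ->; rewrite e_irr.
  have /set2P xab : x \in [set a; b] by rewrite -eqE set21.
  have /set2P yab : y \in [set a; b] by rewrite -eqE set22.
  by case: xab yab neq_xy => -> [] ->; rewrite ?eqxx; auto.
by rewrite cards2 xpair_eqE (negPf neq_ab).
Qed.

Definition commutator_fibre (gT : finGroupType) (G : {set gT}) (g : gT) :
    {set gT * gT} :=
  [set p in setX G G | [~ p.1, p.2]%g == g].

(** The elements of G that conjugate x to z are either none or a coset of the
    centraliser of x, whose order is also that of the centraliser of z. *)
Lemma card_conjugators (gT : finGroupType) (G : {group gT}) (x z : gT) :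
  #|[set y in G | (x ^ y)%g == z]| = (#|'C_G[z]%g| * (z \in x ^: G)%g)%N.
Proof.
have [/imsetP[w Gw ->] | xG'z] := boolP (z \in x ^: G)%g; last first.
  rewrite muln0; apply: eq_card0 => y; rewrite inE.
  by apply: contraNF xG'z => /andP[Gy /eqP<-]; apply: memJ_class.
have -> : [set y in G | (x ^ y)%g == (x ^ w)%g] = ('C_G[x] :* w)%g.
  rewrite -astab1J -(amove_act 'J x (subsetT G) Gw).
  by apply/setP=> y; rewrite !inE.
by rewrite muln1 card_rcoset -conjg_set1 normJ -{2}(conjGid Gw) -conjIg cardJg.
Qed.

(** Frobenius' formula.  Counting x by x makes the number of solutions y an
    inner product of two columns of the character table, at x g and at x; for
    fixed phi, the sum over x is then the convolution of phi with itself
    evaluated at g, a multiple of phi(g) by the row relation. *)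
Lemma card_commutator_fibre (gT : finGroupType) (G : {group gT}) (g : gT) :
  g \in G ->
  #|commutator_fibre G g|%:R
    = #|G|%:R * \sum_(phi <- irr G) phi g / phi 1%g :> algC.
Proof.
move=> Gg.
have -> : #|commutator_fibre G g|
        = (\sum_(x in G) #|[set y in G | (x ^ y)%g == (x * g)%g]|)%N.
  rewrite -sum1_card; under [RHS]eq_bigr do rewrite -sum1_card.
  rewrite pair_big_dep /=; apply: eq_bigl => -[x y] /=; rewrite !inE /= -andbA.
  by rewrite commgEl -(inj_eq (mulgI x)) mulKVg.
rewrite natr_sum.
under eq_bigr => x Gx.
  rewrite card_conjugators natrM mulr_natr -second_orthogonality_relation //.
  over.
rewrite exchange_big /= mulr_sumr big_tuple.
apply: eq_bigr => i _; have := generalized_orthogonality_relation g i i.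
rewrite eqxx mul1r => <-; rewrite mulVKf ?neq0CG //.
by apply: eq_bigr => x _; rewrite irr_inv.
Qed.

Lemma card_commutator_fibreV (gT : finGroupType) (G : {group gT}) (g : gT) :
  #|commutator_fibre G g^-1%g| = #|commutator_fibre G g|.
Proof.
have swapK : involutive (fun p : gT * gT => (p.2, p.1)) by case.
rewrite -(card_imset _ (inv_inj swapK)); apply: eq_card => -[x y].
rewrite -[(x, y)]/((fun p : gT * gT => (p.2, p.1)) (y, x)).
rewrite (mem_imset _ _ (inv_inj swapK)) !inE /= andbC [(_ \in _) && _]andbC.
by rewrite andbC -(inj_eq invg_inj) invgK invgR.
Qed.

Definition diagonal (T : finType) (A : {set T}) : {set T * T} :=
  [set (x, x) | x in A].

Lemma card_diagonal (T : finType) (A : {set T}) : #|diagonal A| = #|A|.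
Proof. by rewrite card_imset // => x y []. Qed.

Lemma diagonal_commutator1 (gT : finGroupType) (G : {group gT}) :
  diagonal G \subset commutator_fibre G 1%g.
Proof. by apply/subsetP=> _ /imsetP[x Gx ->]; rewrite !inE Gx /= commgg. Qed.

Lemma disjoint_commutator_fibres
    (gT : finGroupType) (G : {group gT}) (g h : gT) :
  g != h -> [disjoint commutator_fibre G g & commutator_fibre G h].
Proof.
move=> neq_gh; apply/pred0P=> p /=; rewrite !inE.
by apply: contraNF neq_gh => /andP[/andP[_ /eqP<-] /andP[_ /eqP<-]].
Qed.

(** The adjacent ordered pairs, twice as many as the edges, are the complement
    in G x G of the diagonal and the two fibres. *)
Lemma card_edges_ncgraph (gT : finGroupType) (G : {group gT}) (g : gT) :
  (2 * #|edges (ncgraph G g)|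
   + #|diagonal G :|: (commutator_fibre G g :|: commutator_fibre G g^-1%g)|
   = #|G| * #|G|)%N.
Proof.
rewrite (handshake (@ncgraph_sym _ G g) (@ncgraph_irrefl _ G g)) -cardsX.
set N := _ :|: _; rewrite addnC.
have sND : N \subset setX G G.
  have sF h : commutator_fibre G h \subset setX G G.
    by apply/subsetP=> p /setIdP[].
  rewrite !subUset !sF !andbT.
  by apply/subsetP=> _ /imsetP[x Gx ->]; rewrite inE Gx.
rewrite -(cardsID N (setX G G)) (setIidPr sND); congr (_ + _)%N.
apply: eq_card => -[x y]; rewrite !inE /= /ncgraph.
have -> : ((x, y) \in diagonal G) = (x \in G) && (x == y).
  by apply/imsetP/andP=> [[z Gz [-> ->]] | [Gx /eqP<-]]; [|exists x].
by case: (x \in G); case: (y \in G); rewrite ?andbF ?andbT ?negb_or.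
Qed.

(** Since diagonal pairs commute, they lie in no fibre over g != 1. *)
Lemma card_diagonalU (gT : finGroupType) (G : {group gT}) (g : gT) :
  g != 1%g ->
  #|diagonal G :|: (commutator_fibre G g :|: commutator_fibre G g^-1%g)|
    = (#|G| + #|commutator_fibre G g :|: commutator_fibre G g^-1%g|)%N.
Proof.
move=> ntg; rewrite cardsU card_diagonal disjoint_setI0 ?cards0 ?subn0 //.
apply: disjointWl (diagonal_commutator1 G) _.
rewrite -setI_eq0 setIUr setU_eq0 !setI_eq0.
by rewrite !disjoint_commutator_fibres // eq_sym ?invg_eq1.
Qed.


Theorem corollary3p7 (gT : finGroupType) (G : {group gT}) (g : gT) :
  ~~ abelian G ->
  g \in commutators G ->
  [/\ g = 1%g ->
        2%:R * #|edges (ncgraph G 1%g)|%:R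
        = #|G|%:R * (#|G|%:R - (size (irr G))%:R) :> algC,
      g <> 1%g -> (g ^+ 2)%g = 1%g ->
        2%:R * #|edges (ncgraph G g)|%:R
        = #|G|%:R * (#|G|%:R - 1 - \sum_(phi <- irr G) phi g / phi 1%g) :> algC
    & g <> 1%g -> (g ^+ 2)%g <> 1%g ->
        2%:R * #|edges (ncgraph G g)|%:R
        = #|G|%:R
          * (#|G|%:R - 1 - 2%:R * \sum_(phi <- irr G) phi g / phi 1%g) :> algC].
Proof.
move=> _ /imset2P[x0 y0 Gx0 Gy0 Dg].
have Gg : g \in G by rewrite Dg groupR.
have frob := card_commutator_fibre Gg.
have count h : 2%:R * #|edges (ncgraph G h)|%:R
      = #|G|%:R * #|G|%:R
        - #|diagonal G :|: (commutator_fibre G h :|: commutator_fibre G h^-1%g)|%:R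
      :> algC.
  by rewrite -!natrM -(card_edges_ncgraph G h) natrD addrK.
split=> [g1 | /eqP ntg g2 | /eqP ntg /eqP g2]; rewrite count.
- rewrite invg1 setUid (setUidPr (diagonal_commutator1 G)) -g1 frob g1 mulrBr.
  congr (_ - _ * _); rewrite -sum1_size natr_sum; apply: eq_big_seq => phi.
  by case/irrP=> i ->; rewrite divff ?irr1_neq0.
- rewrite card_diagonalU // natrD.
  have -> : g^-1%g = g by apply/eqP; rewrite eq_invg_mul -expg2 g2.
  by rewrite setUid frob !mulrBr mulr1 opprD addrA.
rewrite card_diagonalU // natrD.
have neq_gV : g != g^-1%g by rewrite eq_sym eq_invg_mul -expg2.
rewrite cardsU disjoint_setI0 ?disjoint_commutator_fibres // cards0 subn0.
rewrite card_commutator_fibreV addnn -mul2n natrM frob.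
by rewrite !mulrBr mulr1 opprD addrA [2%:R * (_ * _)]mulrCA.
Qed.
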